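(* Let $\mathbb{A}$ be a countably infinite set with a fixed bijection $\varrho\colon\mathbb{N}\to\mathbb{A}$. The abstraction functor $[\mathbb{A}]\colon\mathsf{Nom}\to\mathsf{Nom}$ is a lifting of the de Bruijn functor $\mathcal{B}\colon\mathsf{Supp}(\mathbb{A})\to\mathsf{Supp}(\mathbb{A})$. That is, there is a natural isomorphism $\phi\colon\mathcal{B}U\longrightarrow U[\mathbb{A}]$ of functors $\mathsf{Nom}\to\mathsf{Supp}(\mathbb{A})$, where $U\colon\mathsf{Nom}\to\mathsf{Supp}(\mathbb{A})$ is the forgetful functor.
   Context: The natural numbers $\mathbb{N}$ include $0$. $\mathsf{Supp}(\mathbb{A})$: objects are sets $X$ with a map $\mathsf{s}_X\colon X\to\mathcal{P}_{\mathsf f}(\mathbb{A})$ (finite subsets); morphisms $f\colon X\to Y$ are maps with $\mathsf{s}_Y(f(x))\subseteq\mathsf{s}_X(x)$ for all $x\in X$. $\mathsf{Nom}$: let $\mathfrak{S}_{\mathsf f}(\mathbb{A})$ be the group of bijections $\pi\colon\mathbb{A}\to\mathbb{A}$ with $\{a\mid\pi(a)\ne a\}$ finite. A set $S\subseteq\mathbb{A}$ supports an element $x$ of an $\mathfrak{S}_{\mathsf f}(\mathbb{A})$-set if $\pi\cdot x=\pi'\cdot x$ whenever $\pi,\pi'$ agree on $S$. A nominal set is an $\mathfrak{S}_{\mathsf f}(\mathbb{A})$-set in which every element has a finite support; every element then has a least finite support $\mathsf{supp}_X(x)$. $\mathsf{Nom}$ is the category of nominal sets and equivariant maps. $U$ sends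 $(X,\cdot)$ to $(X,\mathsf{supp}_X)$ and maps to themselves. We write $a\mathrel{\#}x$ ($a$ is fresh for $x$) if $a\notin\mathsf{supp}_X(x)$. Abstraction functor: for a nominal set $X$, define on $\mathbb{A}\times X$ the equivalence relation $(a,x)\sim_\alpha(b,y)$ iff there is $c\in\mathbb{A}$ fresh for $a,b,x,y$ with $(c\;a)\cdot x=(c\;b)\cdot y$, where $(c\;a)$ is the transposition. Then $[\mathbb{A}]X=(\mathbb{A}\times X)/{\sim_\alpha}$, with $\langle a\rangle x$ the class of $(a,x)$, action $\pi\cdot\langle a\rangle x=\langle\pi(a)\rangle(\pi\cdot x)$, and $[\mathbb{A}]f(\langle a\rangle x)=\langle a\rangle f(x)$. De Bruijn functor: $\mathcal{B}X$ has the same underlying set as $X$, with the element $x\in X$ written $\lambda.x\in\mathcal{B}X$, and support $\mathsf{s}_{\mathcal{B}X}(\lambda.x)=\{\varrho(k)\mid k\in\mathbb{N},\ \varrho(k+1)\in\mathsf{s}_X(x)\}$; on morphisms, $\mathcal{B}f(\lambda.x)=\lambda.f(x)$. *)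

(* Defs.v *)
From HB Require Import structures.
From mathcomp Require Import all_boot.
From mathcomp Require Import all_classical.

Set Implicit Arguments.
Unset Strict Implicit.
Unset Printing Implicit Defensive.

Local Open Scope classical_set_scope.
Local Open Scope quotient_scope.
Local Open Scope group_scope.

Record category := Category {
  ob :> Type;
  hom : ob -> ob -> Type;
  idm : forall X, hom X X;
  cmp : forall X Y Z, hom Y Z -> hom X Y -> hom X Z;
  cmp1m : forall X Y (f : hom X Y), cmp (idm Y) f = f;
  cmpm1 : forall X Y (f : hom X Y), cmp f (idm X) = f;
  cmpA : forall W X Y Z (h : hom Y Z) (g : hom X Y) (f : hom W X),
    cmp h (cmp g f) = cmp (cmp h g) f }.

Arguments hom {_} _ _.
Arguments idm {_} _.
Arguments cmp {_ _ _ _} _ _.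

Definition is_iso (C : category) (X Y : C) (f : hom X Y) : Prop :=
  exists g : hom Y X, cmp g f = idm X /\ cmp f g = idm Y.

Record functor (C D : category) := Functor {
  fob :> C -> D;
  fmap : forall X Y : C, hom X Y -> hom (fob X) (fob Y);
  fmap1 : forall X : C, fmap (idm X) = idm (fob X);
  fmapM : forall (X Y Z : C) (g : hom Y Z) (f : hom X Y),
    fmap (cmp g f) = cmp (fmap g) (fmap f) }.

Arguments fmap {_ _} _ {_ _} _.

Section FunctorComposition.
Variables (C D E : category) (G : functor D E) (F : functor C D).

Lemma fcomp1 (X : C) : fmap G (fmap F (idm X)) = idm (G (F X)).
Proof. by rewrite !fmap1. Qed.

Lemma fcompM (X Y Z : C) (g : hom Y Z) (f : hom X Y) :
  fmap G (fmap F (cmp g f)) = cmp (fmap G (fmap F g)) (fmap G (fmap F f)).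
Proof. by rewrite !fmapM. Qed.

Definition fcomp : functor C E :=
  @Functor C E (fun X => G (F X)) (fun X Y f => fmap G (fmap F f))
    fcomp1 fcompM.

End FunctorComposition.

Record nat_trans (C D : category) (F G : functor C D) := NatTrans {
  component :> forall X : C, hom (F X) (G X);
  naturality : forall (X Y : C) (f : hom X Y),
    cmp (component Y) (fmap F f) = cmp (fmap G f) (component X) }.

Definition is_nat_iso (C D : category) (F G : functor C D)
  (phi : nat_trans F G) : Prop := forall X : C, is_iso (phi X).

Section Supp.
Variable A : Type.

Record suppSet := SuppSet {
  scar :> Type;
  ssup : scar -> set A;
  ssup_fin : forall x, finite_set (ssup x) }.

Record suppHom (X Y : suppSet) := SuppHom {
  shfun :> X -> Y;
  shP : forall x, ssup (shfun x) `<=` ssup x }.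

Lemma suppHom_eq (X Y : suppSet) (f g : suppHom X Y) : f =1 g -> f = g.
Proof.
case: f g => [f fP] [g gP] /= /funext fg.
by case: _ / fg gP => gP; congr SuppHom; exact: Prop_irrelevance.
Qed.

Definition supp_id (X : suppSet) : suppHom X X :=
  @SuppHom X X (fun x => x) (fun x a xa => xa).

Definition supp_comp (X Y Z : suppSet) (g : suppHom Y Z) (f : suppHom X Y) :
  suppHom X Z.
Proof.
by apply: (@SuppHom X Z (fun x => g (f x))) => x a /shP /shP.
Defined.

Definition Supp : category.
Proof.
by apply: (@Category suppSet suppHom supp_id supp_comp) => *; apply: suppHom_eq.
Defined.

End Supp.

Section FPerm.
Variable A : Type.

Record fperm := FPerm {
  pfun :> A -> A;
  pfun_bij : bijective pfun;
  pfun_fin : finite_set [set a | pfun a <> a] }.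

Lemma fperm_eq (p q : fperm) : p =1 q -> p = q.
Proof.
case: p q => [p pb pf] [q qb qf] /= /funext pq.
by case: _ / pq qb qf => qb qf; congr FPerm; exact: Prop_irrelevance.
Qed.

Definition fperm_one : fperm.
Proof.
apply: (@FPerm (fun a => a)); first by exists (fun a => a).
by apply: (sub_finite_set _ (finite_set0 A)) => a /=.
Defined.

(* (p * q) a = p (q a) *)
Definition fperm_mul (p q : fperm) : fperm.
Proof.
apply: (@FPerm (fun a => p (q a))).
  exact: bij_comp (pfun_bij p) (pfun_bij q).
have fin : finite_set ([set a | p a <> a] `|` [set a | q a <> a]).
  by rewrite finite_setU; split; apply: pfun_fin.
apply: (sub_finite_set _ fin) => a /= pqa.
by have [qa|] := EM (q a = a); [left; rewrite -{1}qa | right].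
Defined.

Lemma fperm_inv_ex (p : fperm) : exists g, cancel p g /\ cancel g p.
Proof. by have [g] := pfun_bij p; exists g. Qed.

Definition fperm_invfun (p : fperm) : A -> A := projT1 (cid (fperm_inv_ex p)).

Lemma fperm_invfunK (p : fperm) : cancel p (fperm_invfun p).
Proof. by rewrite /fperm_invfun; case: cid => g []. Qed.

Lemma fperm_invfunKV (p : fperm) : cancel (fperm_invfun p) p.
Proof. by rewrite /fperm_invfun; case: cid => g []. Qed.

Definition fperm_inv (p : fperm) : fperm.
Proof.
apply: (@FPerm (fperm_invfun p)).
  by exists p; [exact: fperm_invfunKV | exact: fperm_invfunK].
apply: (sub_finite_set _ (pfun_fin p)) => a /= na pa.
by apply: na; rewrite -{1}pa fperm_invfunK.
Defined.

HB.instance Definition _ := gen_eqMixin fperm.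
HB.instance Definition _ := gen_choiceMixin fperm.

Lemma fperm_mulA : associative fperm_mul.
Proof. by move=> p q r; apply: fperm_eq. Qed.
Lemma fperm_mul1p : left_id fperm_one fperm_mul.
Proof. by move=> p; apply: fperm_eq. Qed.
Lemma fperm_mulp1 : right_id fperm_one fperm_mul.
Proof. by move=> p; apply: fperm_eq. Qed.
Lemma fperm_mulVp : left_inverse fperm_one fperm_inv fperm_mul.
Proof. by move=> p; apply: fperm_eq => a /=; rewrite fperm_invfunK. Qed.
Lemma fperm_mulpV : right_inverse fperm_one fperm_inv fperm_mul.
Proof. by move=> p; apply: fperm_eq => a /=; rewrite fperm_invfunKV. Qed.

HB.instance Definition _ := isGroup.Build fperm
  fperm_mulA fperm_mul1p fperm_mulp1 fperm_mulVp fperm_mulpV.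

Lemma fpermM (p q : fperm) a : (p * q) a = p (q a).
Proof. by []. Qed.
Lemma fperm1 a : (1 : fperm) a = a.
Proof. by []. Qed.
Lemma fpermK (p : fperm) a : (p^-1) (p a) = a.
Proof. exact: fperm_invfunK. Qed.
Lemma fpermKV (p : fperm) a : p ((p^-1) a) = a.
Proof. exact: fperm_invfunKV. Qed.
Lemma fperm_inj (p : fperm) : injective p.
Proof. exact: can_inj (fpermK p). Qed.

Definition swap_fun (a b c : A) : A :=
  if `[< c = a >] then b else if `[< c = b >] then a else c.

Lemma swap_funL a b : swap_fun a b a = b.
Proof. by rewrite /swap_fun; case: asboolP. Qed.
Lemma swap_funR a b : swap_fun a b b = a.
Proof. by rewrite /swap_fun; do 2?case: asboolP. Qed.
Lemma swap_funD a b c : c <> a -> c <> b -> swap_fun a b c = c.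
Proof. by rewrite /swap_fun; do 2?case: asboolP. Qed.

Lemma swap_funK a b : involutive (swap_fun a b).
Proof.
move=> c; have [->|ca] := EM (c = a); first by rewrite swap_funL swap_funR.
have [->|cb] := EM (c = b); first by rewrite swap_funR swap_funL.
by rewrite !swap_funD.
Qed.

Definition swap (a b : A) : fperm.
Proof.
apply: (@FPerm (swap_fun a b)).
  by exists (swap_fun a b); exact: swap_funK.
apply: (sub_finite_set _ (finite_set2 a b)) => c /= nc.
by apply: contrapT => /not_orP[ca cb]; apply: nc; rewrite swap_funD.
Defined.

Lemma swapL a b : swap a b a = b. Proof. exact: swap_funL. Qed.
Lemma swapR a b : swap a b b = a. Proof. exact: swap_funR. Qed.
Lemma swapD a b c : c <> a -> c <> b -> swap a b c = c.
Proof. exact: swap_funD. Qed.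
Lemma swapK a b : swap a b * swap a b = 1.
Proof. by apply: fperm_eq => c; apply: swap_funK. Qed.
Lemma swapC a b : swap a b = swap b a.
Proof.
apply: fperm_eq => c; have [->|ca] := EM (c = a); first by rewrite swapL swapR.
have [->|cb] := EM (c = b); first by rewrite swapR swapL.
by rewrite !swapD.
Qed.
Lemma swapxx a : swap a a = 1.
Proof.
apply: fperm_eq => c; have [->|ca] := EM (c = a); first by rewrite swapL.
by rewrite swapD.
Qed.

Lemma swap_conj (p : fperm) a b : p * swap a b = swap (p a) (p b) * p.
Proof.
apply: fperm_eq => c; rewrite !fpermM.
have [->|ca] := EM (c = a); first by rewrite !swapL.
have [->|cb] := EM (c = b); first by rewrite !swapR.
by rewrite !swapD // => /fperm_inj.
Qed.

End FPerm.

Section Nom.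
Variable A : Type.

Definition supports (X : Type) (act : fperm A -> X -> X) (S : set A) (x : X) :=
  forall p q : fperm A, (forall a, S a -> p a = q a) -> act p x = act q x.

Record nomSet := NomSet {
  ncar :> Type;
  act : fperm A -> ncar -> ncar;
  act1 : forall x, act 1 x = x;
  actM : forall p q x, act (p * q) x = act p (act q x);
  fin_supported : forall x, exists S : set A, finite_set S /\ supports act S x }.

(* The intersection of all finite supports; [supp_least] below shows that it is
   the least finite support, as soon as A is infinite. *)
Definition supp (X : nomSet) (x : X) : set A :=
  [set a | forall S : set A, finite_set S -> supports (@act X) S x -> S a].

Definition fresh (X : nomSet) (a : A) (x : X) : Prop := ~ supp x a.

Lemma supp_fin (X : nomSet) (x : X) : finite_set (supp x).
Proof.
have [S [Sf Sx]] := fin_supported x.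
by apply: (sub_finite_set _ Sf) => a; apply.
Qed.

Record nomHom (X Y : nomSet) := NomHom {
  nhfun :> X -> Y;
  nhP : forall p x, nhfun (act p x) = act p (nhfun x) }.

Lemma nomHom_eq (X Y : nomSet) (f g : nomHom X Y) : f =1 g -> f = g.
Proof.
case: f g => [f fP] [g gP] /= /funext fg.
by case: _ / fg gP => gP; congr NomHom; exact: Prop_irrelevance.
Qed.

Definition nom_id (X : nomSet) : nomHom X X :=
  @NomHom X X (fun x => x) (fun p x => erefl).

Definition nom_comp (X Y Z : nomSet) (g : nomHom Y Z) (f : nomHom X Y) :
  nomHom X Z.
Proof. by apply: (@NomHom X Z (fun x => g (f x))) => p x; rewrite !nhP. Defined.

Definition Nom : category.
Proof.
by apply: (@Category nomSet nomHom nom_id nom_comp) => *; apply: nomHom_eq.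
Defined.

Lemma supp_hom (X Y : nomSet) (f : nomHom X Y) x : supp (f x) `<=` supp x.
Proof.
move=> a sa S Sf Sx; apply: sa => // p q pq.
by rewrite -!nhP (Sx p q).
Qed.

Definition forget_ob (X : nomSet) : suppSet A := SuppSet (@supp_fin X).

Definition forget_map (X Y : nomSet) (f : nomHom X Y) :
  suppHom (forget_ob X) (forget_ob Y) :=
  @SuppHom A (forget_ob X) (forget_ob Y) f (fun x => @supp_hom X Y f x).

Definition forget : functor Nom (Supp A).
Proof.
by apply: (@Functor Nom (Supp A) forget_ob forget_map) => *; apply: suppHom_eq.
Defined.

Lemma actK (X : nomSet) p (x : X) : act p^-1 (act p x) = x.
Proof. by rewrite -actM mulVg act1. Qed.

Lemma actKV (X : nomSet) p (x : X) : act p (act p^-1 x) = x.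
Proof. by rewrite -actM mulgV act1. Qed.

Lemma supports_swap (X : nomSet) (S : set A) (x : X) a b :
  supports (@act X) S x -> ~ S a -> ~ S b -> act (swap a b) x = x.
Proof.
move=> Sx Sa Sb; rewrite -[RHS]act1; apply: Sx => c Sc.
by rewrite swapD // => ca; [apply: Sa | apply: Sb]; rewrite -ca.
Qed.

Lemma swap_supports (X : nomSet) (S : set A) (x : X) :
  (forall a b, ~ S a -> ~ S b -> act (swap a b) x = x) ->
  supports (@act X) S x.
Proof.
move=> Sx; suff fixS (p : fperm A) : (forall a, S a -> p a = a) -> act p x = x.
  move=> p q pq; rewrite -[LHS](actKV q) -[act _ (act p x)]actM fixS // => a Sa.
  by rewrite fpermM pq // fpermK.
have /(finite_seqP (T := {classic A}))[s sp] := pfun_fin p.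
have {sp} : forall a : {classic A}, p a <> a -> a \in s.
  by move=> a pa; have : [set` s] a by rewrite -sp.
elim: s p => [|a s IH] p ps pS.
  have -> : p = 1 by apply: fperm_eq => a; apply: contrapT => /ps.
  exact: act1.
have [pa|pa] := EM (p a = a).
  apply: IH => // b pb; have := ps _ pb; rewrite inE => /orP[/eqP ba|//].
  by case: pb; rewrite ba.
have Sa : ~ S a by move=> Sa; apply: pa; exact: pS.
have ppa : p (p a) <> p a by move=> e; apply: pa; exact: fperm_inj e.
have Spa : ~ S (p a) by move=> Spa; apply: ppa; exact: pS.
rewrite -[LHS](actK (swap a (p a))) -[act _ (act p x)]actM IH.
- by rewrite -{1}(Sx _ _ Sa Spa) actK.
- move=> b; rewrite fpermM.
  have [->|ba] := EM (b = a); first by rewrite swapR.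
  move=> nb; have [pb|pb] := EM (p b = b).
    have bpa : b <> p a by move=> e; apply: ppa; rewrite -e.
    by case: nb; rewrite pb swapD.
  by have := ps _ pb; rewrite inE => /orP[/eqP|].
- move=> b Sb; rewrite fpermM (pS b) // swapD // => e; [apply: Sa | apply: Spa].
    by rewrite -e.
  by rewrite -e.
Qed.

Hypothesis infA : infinite_set [set: A].

Lemma fresh_ex (S : set A) : finite_set S -> exists a, ~ S a.
Proof.
move=> Sf; apply: contrapT => /forallNP nS; apply: infA.
by apply: (sub_finite_set _ Sf) => a _; apply: contrapT; apply: nS.
Qed.

Lemma supp_supports (X : nomSet) (x : X) : supports (@act X) (supp x) x.
Proof.
apply: swap_supports => a b na nb.
have swapE d : fresh d x -> exists S, [/\ finite_set S, supports (@act X) S x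
    & ~ S d].
  by move=> /existsNP[S /not_implyP[Sf /not_implyP[Sx Sd]]]; exists S.
have [S [Sf Sx Sa]] := swapE _ na; have [T [Tf Tx Tb]] := swapE _ nb.
have [d] : exists d, ~ (S `|` T `|` [set a; b]) d.
  by apply: fresh_ex; rewrite !finite_setU; do !split => //; exact: finite_set1.
move=> /not_orP[/not_orP[Sd Td] /not_orP[da db]].
have [->|ab] := EM (a = b); first by rewrite swapxx act1.
have -> : swap a b = swap a d * swap d b * swap a d.
  rewrite -mulgA (_ : swap d b * _ = swap a d * swap a b).
    by rewrite mulgA swapK mul1g.
  by rewrite [RHS]swap_conj swapL swapD //; exact: nesym.
by rewrite !actM (supports_swap Sx) // (supports_swap Tx) // (supports_swap Sx).
Qed.

Lemma supp_least (X : nomSet) (x : X) :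
  [/\ finite_set (supp x), supports (@act X) (supp x) x
    & forall S : set A, finite_set S -> supports (@act X) S x -> supp x `<=` S].
Proof.
split; [exact: supp_fin | exact: supp_supports |].
by move=> S Sf Sx a; apply.
Qed.

Lemma fresh_swap (X : nomSet) (x : X) a b :
  fresh a x -> fresh b x -> act (swap a b) x = x.
Proof. exact/supports_swap/supp_supports. Qed.

Lemma fresh_act (X : nomSet) (x : X) (p : fperm A) a : fresh a x -> fresh (p a) (act p x).
Proof.
move=> ax pax; apply: ax => S Sf Sx.
suff: (p @` S) (p a) by move=> [b Sb e]; rewrite -(fperm_inj e).
apply: pax; first exact: finite_image.
move=> q r qr; rewrite -!actM; apply: Sx => b Sb.
by rewrite !fpermM qr //; exists b.
Qed.

Section Abstraction.
Variable X : nomSet.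

(* "c is fresh for the atom a" means c <> a, as supp a = {a}. *)
Definition alpha (u v : A * X) : Prop :=
  exists c, [/\ c <> u.1, c <> v.1, fresh c u.2, fresh c v.2
    & act (swap c u.1) u.2 = act (swap c v.1) v.2].

Lemma alpha_any (u v : A * X) d : alpha u v ->
  d <> u.1 -> d <> v.1 -> fresh d u.2 -> fresh d v.2 ->
  act (swap d u.1) u.2 = act (swap d v.1) v.2.
Proof.
case: u v => [a x] [b y] [c /= [ca cb cx cy e]] da db dx dy.
have key (a' : A) (x' : X) : c <> a' -> d <> a' -> fresh c x' -> fresh d x' ->
    act (swap d a') x' = act (swap d c) (act (swap c a') x').
  move=> ca' da' cx' dx'.
  rewrite -actM swap_conj swapR swapD; try exact: nesym.
  by rewrite actM (fresh_swap dx' cx').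
by rewrite key // e -key.
Qed.

Lemma alpha_fresh (u v w : A * X) : exists c,
  [/\ c <> u.1, c <> v.1, c <> w.1 & [/\ fresh c u.2, fresh c v.2 & fresh c w.2]].
Proof.
have [c] : exists c, ~ (([set u.1; v.1] `|` [set w.1]) `|`
    ((supp u.2 `|` supp v.2) `|` supp w.2)) c.
  apply: fresh_ex; rewrite !finite_setU.
  by do !split; by [exact: finite_set1 | exact: supp_fin].
move=> /not_orP[/not_orP[/not_orP[cu cv] cw] /not_orP[/not_orP[fu fv] fw]].
by exists c; split.
Qed.

Lemma alpha_refl (u : A * X) : alpha u u.
Proof. by have [c [cu _ _ [fu _ _]]] := alpha_fresh u u u; exists c. Qed.

Lemma alpha_sym (u v : A * X) : alpha u v -> alpha v u.
Proof. by move=> [c [? ? ? ? ?]]; exists c. Qed.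

Lemma alpha_trans (u v w : A * X) : alpha u v -> alpha v w -> alpha u w.
Proof.
move=> uv vw; have [c [cu cv cw [fu fv fw]]] := alpha_fresh u v w.
by exists c; split=> //; rewrite (alpha_any uv) // (alpha_any vw).
Qed.

Lemma alpha_act (p : fperm A) (u v : A * X) :
  alpha u v -> alpha (p u.1, act p u.2) (p v.1, act p v.2).
Proof.
move=> [c [cu cv fu fv e]]; exists (p c) => /=; split.
- by move=> e'; apply: cu; exact: fperm_inj e'.
- by move=> e'; apply: cv; exact: fperm_inj e'.
- exact: fresh_act.
- exact: fresh_act.
- by rewrite -!actM -!swap_conj !actM e.
Qed.

Definition alphab : rel {classic A * X} := fun u v => `[< alpha u v >].

Lemma alphab_equiv : equiv_class_of alphab.
Proof.
split=> [u | u v | v u w]; first exact/asboolP/alpha_refl.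
  by apply/asboolP/asboolP; exact: alpha_sym.
by move=> /asboolP uv /asboolP vw; apply/asboolP; exact: alpha_trans uv vw.
Qed.

Definition alpha_equiv : equiv_rel {classic A * X} := EquivRelPack alphab_equiv.

Definition abs_car : Type := {eq_quot alpha_equiv}.

Definition abs_mk (a : A) (x : X) : abs_car :=
  \pi_({eq_quot alpha_equiv}) ((a, x) : {classic A * X}).

Lemma abs_mkP a x b y : abs_mk a x = abs_mk b y <-> alpha (a, x) (b, y).
Proof.
split=> [/eqmodP/asboolP //|h]; exact/eqmodP/asboolP.
Qed.

Definition abs_repr (z : abs_car) : A * X :=
  repr (z : {eq_quot alpha_equiv}).

Lemma abs_reprK z : abs_mk (abs_repr z).1 (abs_repr z).2 = z.
Proof. by rewrite /abs_mk -surjective_pairing; exact: reprK. Qed.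

Lemma abs_mkK a x : alpha (abs_repr (abs_mk a x)) (a, x).
Proof.
by rewrite [abs_repr _]surjective_pairing -abs_mkP abs_reprK.
Qed.

(* Defined on a representative; [abs_actE] is the equation on classes. *)
Definition abs_act (p : fperm A) (z : abs_car) : abs_car :=
  abs_mk (p (abs_repr z).1) (act p (abs_repr z).2).

Lemma abs_actE (p : fperm A) a x : abs_act p (abs_mk a x) = abs_mk (p a) (act p x).
Proof. by apply/abs_mkP; exact: alpha_act (abs_mkK a x). Qed.

Definition abs_ob : nomSet.
Proof.
apply: (@NomSet abs_car abs_act).
- by move=> z; rewrite -[z]abs_reprK abs_actE act1.
- by move=> p q z; rewrite -[z]abs_reprK !abs_actE actM.
- move=> z; exists ([set (abs_repr z).1] `|` supp (abs_repr z).2); split.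
    by rewrite finite_setU; split; [exact: finite_set1 | exact: supp_fin].
  move=> p q pq; rewrite -[z]abs_reprK !abs_actE pq; last by left.
  by congr abs_mk; apply: supp_supports => a sa; apply: pq; right.
Defined.

End Abstraction.

Lemma fresh_hom (X Y : nomSet) (f : nomHom X Y) a x : fresh a x -> fresh a (f x).
Proof. by move=> ax /supp_hom. Qed.

(* Defined on a representative; [abs_funE] is the equation on classes. *)
Definition abs_fun (X Y : nomSet) (f : nomHom X Y) (z : abs_ob X) : abs_ob Y :=
  abs_mk (abs_repr z).1 (f (abs_repr z).2).

Lemma abs_funE (X Y : nomSet) (f : nomHom X Y) a x :
  abs_fun f (abs_mk a x) = abs_mk a (f x).
Proof.
apply/abs_mkP; have [c [ca cb fa fb e]] := abs_mkK a x.
by exists c; split=> //=; [exact: fresh_hom..|rewrite -!nhP e].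
Qed.

Definition abs_map (X Y : nomSet) (f : nomHom X Y) :
  nomHom (abs_ob X) (abs_ob Y).
Proof.
apply: (@NomHom (abs_ob X) (abs_ob Y) (abs_fun f)) => p z /=.
by rewrite -[z]abs_reprK abs_actE !abs_funE abs_actE nhP.
Defined.

Definition abstraction : functor Nom Nom.
Proof.
apply: (@Functor Nom Nom abs_ob abs_map) => [X | X Y Z g f];
  apply: nomHom_eq => z /=; rewrite -[z]abs_reprK !abs_funE //.
Defined.

End Nom.

Section DeBruijn.
Variables (A : Type) (rho : nat -> A).
Hypothesis rho_bij : bijective rho.

Lemma bij_nat_infinite : infinite_set [set: A].
Proof.
have [r rhoK rK] := rho_bij.
move=> /(finite_image r) fin; apply: infinite_nat.
by apply: (sub_finite_set _ fin) => k _; exists (rho k).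
Qed.

(* The carrier is that of X: the constructor written λ.x is the identity. *)
Definition db_ob (X : suppSet A) : suppSet A.
Proof.
apply: (@SuppSet A X (fun x => [set rho k | k in [set k | ssup x (rho k.+1)]])).
move=> x; apply: finite_image; have [r rhoK rK] := rho_bij.
apply: (sub_finite_set _ (finite_image (fun a => (r a).-1) (ssup_fin x))) => k /= xk.
by exists (rho k.+1) => //; rewrite rhoK.
Defined.

Definition db_map (X Y : suppSet A) (f : suppHom X Y) :
  suppHom (db_ob X) (db_ob Y).
Proof.
apply: (@SuppHom A (db_ob X) (db_ob Y) f) => x /=.
by apply: image_subset => k; exact: shP.
Defined.

Definition deBruijn : functor (Supp A) (Supp A).
Proof.
by apply: (@Functor (Supp A) (Supp A) db_ob db_map) => *; apply: suppHom_eq.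
Defined.

End DeBruijn.

(* Main.v *)
Require Import Defs.
From mathcomp Require Import all_boot.
From mathcomp Require Import all_classical.

(** Write [k] for [rho k].  The cycle [c_n] sending [0] to [n] and [k+1] to [k]
    for [k < n] performs the index shift of the de Bruijn functor on every [x]
    supported by [0, ..., n], and [phi x] is [<n>(c_n x)].  Passing from [n] to
    [n+1] applies the transposition [(n n+1)], which fixes [<n>(c_n x)], so
    [phi x] does not depend on [n]; naturality follows, and comparing two
    elements (or reaching a given abstraction) at a common large [n] makes
    [phi x] a support-preserving bijection. *)

Set Implicit Arguments.
Unset Strict Implicit.
Unset Printing Implicit Defensive.

Local Open Scope classical_set_scope.
Local Open Scope group_scope.

(** A bijective morphism may shrink supports, and its inverse would then enlarge them; the third
    hypothesis excludes this. *)
Lemma supp_iso (A : Type) (X Y : Supp A) (f : hom X Y) :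
  injective (f : suppHom X Y) -> (forall y, exists x, (f : suppHom X Y) x = y) ->
  (forall x, ssup x `<=` ssup ((f : suppHom X Y) x)) -> is_iso f.
Proof.
move=> finj fsurj fsup.
pose g y := projT1 (cid (fsurj y)).
have gK y : (f : suppHom X Y) (g y) = y by rewrite /g; case: cid.
have gsup y : ssup (g y) `<=` ssup y by rewrite -{2}(gK y); exact: fsup.
exists (SuppHom gsup); split; apply: suppHom_eq => x /=; last exact: gK.
by apply: finj; rewrite gK.
Qed.

Section AbstractionSupport.
Variables (A : Type) (infA : infinite_set [set: A]) (X : nomSet A).
Implicit Types (a b d : A) (x y : X).

Lemma fresh_actE (p : fperm A) a x : fresh (p a) (act p x) <-> fresh a x.
Proof.
split=> [|ax]; last exact: fresh_act.
by move=> /(fresh_act (p := p^-1)); rewrite fpermK actK.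
Qed.

Lemma act_inj (p : fperm A) : injective (@act A X p).
Proof. exact: can_inj (@actK A X p). Qed.

Lemma abs_mk_inj a : injective (abs_mk infA (X := X) a).
Proof. by move=> x y /abs_mkP[c /= [_ _ _ _ /act_inj]]. Qed.

(** For [c] fresh, (c d)(a d) = (a c)(c d), and (c d) fixes [x] because [c] and [d] are fresh for
    it. *)
Lemma abs_mk_rename a d x :
  fresh d x -> abs_mk infA d (act (swap a d) x) = abs_mk infA a x.
Proof.
have [->|da] := EM (d = a); first by rewrite swapxx act1.
move=> dx; apply/abs_mkP.
have [c [/= ca cd _ [cx cx' _]]] :=
  alpha_fresh infA (a, x) (d, act (swap a d) x) (a, x).
exists c; split=> //=.
rewrite -actM swap_conj swapD; [|exact: nesym..].
by rewrite swapR actM (fresh_swap infA cx dx) swapC.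
Qed.

(** If [S] supports <a>x, then [S] with [a] added supports [x], because <a> is injective.
    Conversely, a transposition of atoms outside supp(x) - {a} fixes <a>x: it renames the bound atom
    if it moves [a], and fixes [x] otherwise. *)
Lemma supp_abs_mk a x :
  supp (abs_mk infA a x : abs_ob infA X) = supp x `\ a.
Proof.
apply/seteqP; split=> [b | b [xb ba] S Sf Sax]; last first.
  suff [] : (a |` S) b by [].
  apply: xb; first by rewrite finite_setU; split=> //; exact: finite_set1.
  move=> p q pq; have pqa : p a = q a by apply: pq; left.
  apply: (@abs_mk_inj (p a)); rewrite {2}pqa -!abs_actE.
  by apply: Sax => c Sc; apply: pq; right.
apply; first exact/finite_setD/supp_fin.
apply: swap_supports => {}b d nb nd /=; rewrite abs_actE.
have freshP c : ~ (supp x `\ a) c -> c <> a -> fresh c x.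
  by move=> nc ca cx; apply: nc.
have [ba|ba] := EM (b = a); have [da|da] := EM (d = a).
- by rewrite ba da swapxx act1.
- by rewrite ba swapL abs_mk_rename //; exact: freshP.
- by rewrite da swapR swapC abs_mk_rename //; exact: freshP.
- by rewrite swapD; [rewrite fresh_swap //; exact: freshP | exact: nesym..].
Qed.

End AbstractionSupport.

Section Shift.
Variables (A : Type) (rho : nat -> A) (rho_bij : bijective rho).
Let infA := bij_nat_infinite rho_bij.
Let rho_inj : injective rho := bij_inj rho_bij.

(** The cycle c_n as the product (n-1 n)...(0 1), so that c_{n+1} is c_n followed by a single
    transposition. *)
Fixpoint shift n : fperm A :=
  if n is m.+1 then swap (rho m) (rho m.+1) * shift m else 1.

Lemma rho_neq i j : i != j -> rho i <> rho j.
Proof. by move=> /eqP ij /rho_inj. Qed.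

Lemma shift_gt n k : n < k -> shift n (rho k) = rho k.
Proof.
elim: n k => [|n IH] k nk //; rewrite fpermM IH ?(ltnW nk) //.
by rewrite swapD //; apply: rho_neq; rewrite gtn_eqF // ltnW.
Qed.

Lemma shift_lt n k : k < n -> shift n (rho k.+1) = rho k.
Proof.
elim: n k => [//|n IH] k; rewrite ltnS leq_eqVlt fpermM => /orP[/eqP->|kn].
  by rewrite shift_gt // swapR.
by rewrite IH // swapD //; apply: rho_neq; rewrite ltn_eqF // ltnW.
Qed.

Lemma finite_set_rho_bound (S : set A) :
  finite_set S -> exists n, forall k, n < k -> ~ S (rho k).
Proof.
have [r rhoK _] := rho_bij.
move=> /(finite_image r)/finite_seqP[s Ss].
exists (\max_(i <- s) i) => k nk Sk; have ks : k \in s.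
  by have : [set` s] k; [rewrite -Ss; exists (rho k)|].
by have := leq_bigmax_seq (F := id) k ks isT; rewrite leqNgt nk.
Qed.

Section Bind.
Variable X : nomSet A.
Implicit Type x : X.

(** Any upper bound qualifies, not only the largest index in the support, so that several elements
    can share one. *)
Definition bound_at n x := forall k, n < k -> fresh (rho k) x.

Lemma bound_at_ex x : exists n, bound_at n x.
Proof. exact/finite_set_rho_bound/supp_fin. Qed.

Lemma bound_at_le m n x : m <= n -> bound_at m x -> bound_at n x.
Proof. by move=> mn xm k nk; apply: xm; exact: leq_ltn_trans nk. Qed.

Definition bind_at n x : abs_ob infA X := abs_mk infA (rho n) (act (shift n) x).

Lemma bind_atS n x : bound_at n x -> bind_at n.+1 x = bind_at n x.
Proof.
move=> xn; rewrite /bind_at /= actM abs_mk_rename //.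
(* c_n fixes n+1, which is therefore as fresh for c_n x as for [x]. *)
by rewrite -(shift_gt (ltnSn n)); apply/fresh_actE/xn.
Qed.

Lemma bind_at_le m n x : m <= n -> bound_at m x -> bind_at n x = bind_at m x.
Proof.
elim: n => [|n IH]; first by rewrite leqn0 => /eqP->.
rewrite leq_eqVlt => /orP[/eqP-> //|mn] xm.
by rewrite bind_atS ?IH //; exact: bound_at_le xm.
Qed.

Definition bind x : abs_ob infA X := bind_at (projT1 (cid (bound_at_ex x))) x.

Lemma bindE n x : bound_at n x -> bind x = bind_at n x.
Proof.
rewrite /bind; case: cid => m /= xm xn.
case: (leqP m n) => [|/ltnW] mn; first by rewrite (bind_at_le mn).
by rewrite -(bind_at_le mn).
Qed.

Lemma supp_bind x k : supp (bind x) (rho k) <-> supp x (rho k.+1).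
Proof.
have [n xn] := bound_at_ex x.
rewrite (bindE xn) /bind_at supp_abs_mk.
(* For k < n, c_n moves k+1 to k. For k > n, neither side holds. At k = n, the binder removes n on
   the left and the bound excludes n+1 on the right. *)
have [kn|nk|->] := ltngtP k n.
- rewrite -(shift_lt kn); split=> [[xk _]|xk].
    by apply: contrapT => /(fresh_act (p := shift n)).
  split; first by apply: contrapT => /fresh_actE.
  by rewrite shift_lt //; apply: rho_neq; rewrite ltn_eqF.
- split=> [[xk _]|xk]; last by case: (xn k.+1 (leqW nk)).
  suff: fresh (rho k) (act (shift n) x) by case.
  by rewrite -(shift_gt nk); apply/fresh_actE/xn.
- by split=> [[_ []]//|xn1]; case: (xn _ (ltnSn n)).
Qed.

Lemma bind_inj : injective bind.
Proof.
move=> x y; have [m xm] := bound_at_ex x; have [n yn] := bound_at_ex y.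
rewrite (bindE (bound_at_le (leq_maxl m n) xm)).
rewrite (bindE (bound_at_le (leq_maxr m n) yn)).
by move=> /(@abs_mk_inj _ _ _ _ _ _)/act_inj.
Qed.

Lemma bind_surj (z : abs_ob infA X) : exists x, bind x = z.
Proof.
rewrite -[z]abs_reprK; move: (abs_repr z) => -[a y] /=.
have [m ym] := bound_at_ex y; have [l al] := finite_set_rho_bound (finite_set1 a).
(* The successor makes [rho n] itself fresh for [y] and distinct from [a], so that [a] can be
   renamed to [rho n]. *)
pose n := (maxn m l).+1.
have mn k : n <= k -> fresh (rho k) y.
  by move=> nk; apply: ym; apply: leq_trans nk; rewrite ltnS leq_maxl.
have ln k : n <= k -> rho k <> a.
  by move=> nk; apply: al; apply: leq_trans nk; rewrite ltnS leq_maxr.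
exists (act (shift n)^-1 (act (swap a (rho n)) y)).
rewrite (@bindE n) ?/bind_at ?actKV ?abs_mk_rename //; first exact: mn.
(* For k > n, both c_n and (a n) fix [rho k], so its freshness for [y] passes to the preimage. *)
move=> k nk; apply/(fresh_actE (shift n)); rewrite actKV shift_gt //.
rewrite -(@swapD _ a (rho n) (rho k)); [| exact/ln/ltnW |].
  exact/fresh_act/mn/ltnW.
by apply: rho_neq; rewrite gtn_eqF.
Qed.

Lemma bind_supp_le x : supp (bind x) `<=`
  [set rho k | k in [set k | supp x (rho k.+1)]].
Proof.
have [r _ rK] := rho_bij.
by move=> a; rewrite -(rK a) => /supp_bind xk; exists (r a).
Qed.

End Bind.

(** Since [f] does not enlarge supports, a bound for [x] also serves [f x]; at that common bound,
    equivariance of [f] suffices. *)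
Lemma bind_natural (X Y : nomSet A) (f : nomHom X Y) (x : X) :
  bind (f x) = abs_map infA f (bind x).
Proof.
have [n xn] := bound_at_ex x.
have fxn : bound_at n (f x) by move=> k nk; exact/fresh_hom/xn.
by rewrite (bindE xn) (bindE fxn) /= abs_funE nhP.
Qed.

Definition bind_hom (X : nomSet A) :
  suppHom (db_ob rho_bij (forget_ob X)) (forget_ob (abs_ob infA X)) :=
  @SuppHom A (db_ob rho_bij (forget_ob X)) (forget_ob (abs_ob infA X))
    (@bind X) (@bind_supp_le X).

End Shift.

Theorem theorem5p9 (A : Type) (rho : nat -> A) (rho_bij : bijective rho) :
  exists phi : nat_trans
      (fcomp (deBruijn rho_bij) (forget A))
      (fcomp (forget A) (abstraction (bij_nat_infinite rho_bij))),
    is_nat_iso phi.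
Proof.
unshelve eexists (@NatTrans _ _ (fcomp (deBruijn rho_bij) (forget A))
  (fcomp (forget A) (abstraction (bij_nat_infinite rho_bij)))
  (@bind_hom A rho rho_bij) _).
  by move=> X Y f; apply: suppHom_eq => x; exact: bind_natural.
move=> X; apply: supp_iso => /=; [exact: bind_inj | exact: bind_surj |].
(* The reverse inclusion of supports, which makes the inverse a morphism. *)
by move=> x a [k xk <-]; exact/supp_bind.
Qed.
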